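(* Let $h$ be a continuous proper exhaustion of $A$ and let $\varphi$ be an admissible comparison function. (a) Property (VAN) holds if and only if $D_h(\lambda)<\infty$ for every $\lambda\ge1$. (b) Property (INV) holds if and only if $D_h(\lambda)<\infty$ and $E_h(\lambda)<\infty$ for every $\lambda\ge1$. (c) If $h(A)\supseteq[t_0,\infty)$ for some $t_0<\infty$ (in particular if $A$ is connected, since then $h(A)$ is an unbounded interval), then (INV), (VAN) and globally bounded dilation of $\varphi$ (i.e. $D(\lambda)<\infty$ for every $\lambda\ge1$) are all equivalent.
   Context: $A$ is a non-compact, locally compact, $\sigma$-compact Hausdorff space. A continuous proper exhaustion is a continuous $h:A\to[0,\infty)$ such that $h^{-1}([0,R])$ is compact for every $R<\infty$. $C(A)$ is the space of real continuous functions on $A$. Two functions $h,h':A\to[0,\infty)$ are coarsely affinely equivalent, written $h\sim h'$, if there are $a_1,a_2>0$ and $b_1,b_2\ge0$ with $a_1h-b_1\le h'\le a_2h+b_2$ on $A$. An admissible comparison function is a function $\varphi:[0,\infty)\to[1,\infty)$ such that (A1) $\varphi$ is continuous, non-decreasing and $\varphi(0)=1$; (A2) there is $K\ge1$ with $\varphi(r+s)\le K\varphi(r)\varphi(s)$ for all $r,s\ge0$. For $f\in C(A)$, $L\in\mathbb{R}$: $C^{(h)}_\varphi(f;L):=\limsup_{h(a)\to\infty}\varphi(h(a))|f(a)-L|=\lim_{R\to\infty}\sup_{\{h>R\}}\varphi(h)|f-L|\in[0,\infty]$. (INV): for every continuous proper exhaustion $h'$ with $h'\sim h$ there is $C\ge1$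 with $C^{-1}C^{(h)}_\varphi(f;L)\le C^{(h')}_\varphi(f;L)\le C\,C^{(h)}_\varphi(f;L)$ for all $f\in C(A)$, $L\in\mathbb{R}$. (VAN): for every continuous proper exhaustion $h'$ with $h'\sim h$ and all $f\in C(A)$, $L\in\mathbb{R}$: $C^{(h)}_\varphi(f;L)=0\Rightarrow C^{(h')}_\varphi(f;L)=0$. For $\lambda\ge1$ (values in $[1,\infty]$): $D_h(\lambda):=\sup_{t\in h(A)}\varphi(\lambda t)/\varphi(t)$, $E_h(\lambda):=\sup_{t\in h(A)}\varphi(t)/\varphi(t/\lambda)$, $D(\lambda):=\sup_{t\ge0}\varphi(\lambda t)/\varphi(t)$. *)

(* Defs.v *)
From HB Require Import structures.
From mathcomp Require Import all_boot all_order all_algebra.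
From mathcomp Require Import all_classical all_reals all_analysis.

Set Implicit Arguments.
Unset Strict Implicit.
Unset Printing Implicit Defensive.

Import Order.TTheory GRing.Theory Num.Theory numFieldNormedType.Exports.

Local Open Scope classical_set_scope.
Local Open Scope ring_scope.

Definition sigma_compact (A : topologicalType) : Prop :=
  exists K : nat -> set A,
    (forall n, compact (K n)) /\ \bigcup_n K n = [set: A].

Definition proper_exhaustion (R : realType) (A : topologicalType)
    (h : A -> R) : Prop :=
  [/\ forall a, 0 <= h a,
      continuous h
    & forall r : R, compact (h @^-1` `[0, r])].

Definition coarsely_affine (R : realType) (A : Type) (h h' : A -> R) : Prop :=
  exists a1 a2 b1 b2 : R,
    [/\ 0 < a1, 0 < a2, 0 <= b1, 0 <= b2
      & forall a, a1 * h a - b1 <= h' a <= a2 * h a + b2].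

(* Functions on [0, +oo[ are represented by functions on R, of which only the
   restriction to [0, +oo[ is constrained and used. *)
Definition admissible (R : realType) (phi : R -> R) : Prop :=
  [/\ forall t, 0 <= t -> 1 <= phi t,
      {within `[0, +oo[, continuous phi},
      {in `[0, +oo[ &, {homo phi : s t / s <= t}},
      phi 0 = 1
    & exists2 K : R, 1 <= K &
        forall r s, 0 <= r -> 0 <= s -> phi (r + s) <= K * phi r * phi s].

(* The filter "h(a) --> +oo" on A. *)
Definition at_infinity (R : realType) (A : Type) (h : A -> R) : set_system A :=
  filter_from [set: R] (fun M => [set a | M < h a]).

Definition Climsup (R : realType) (A : topologicalType) (phi : R -> R)
    (h f : A -> R) (L : R) : \bar R :=
  limf_esup (fun a => (phi (h a) * `|f a - L|)%:E) (at_infinity h).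

Lemma Climsup_cvg (R : realType) (A : topologicalType) (phi : R -> R)
    (h f : A -> R) (L : R) :
  ereal_sup [set (phi (h a) * `|f a - L|)%:E | a in [set a | M < h a]]
    @[M --> +oo] --> Climsup phi h f L.
Proof.
set g := fun a => (phi (h a) * `|f a - L|)%:E.
set S := fun M : R => ereal_sup (g @` [set a | M < h a]).
have -> : Climsup phi h f L = ereal_inf (range S).
  apply/eqP; rewrite /Climsup limf_esupE eq_le; apply/andP; split.
    apply: ereal_inf_le_tmp => _ [M _ <-].
    by exists [set a | M < h a] => //; exists M.
  apply: le_ereal_inf_tmp => _ [V [M _ MV] <-].
  apply: ge_ereal_inf; exists (S M); first by exists M.
  exact/ereal_sup_le/image_subset.
apply: nonincreasing_cvge => M N MN; apply/ereal_sup_le/image_subset => a /=.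
exact: le_lt_trans.
Qed.

Definition INV (R : realType) (A : topologicalType) (phi : R -> R)
    (h : A -> R) : Prop :=
  forall h' : A -> R, proper_exhaustion h' -> coarsely_affine h' h ->
  exists2 C : R, 1 <= C & forall (f : A -> R) (L : R), continuous f ->
    (C^-1%:E * Climsup phi h f L <= Climsup phi h' f L)%E /\
    (Climsup phi h' f L <= C%:E * Climsup phi h f L)%E.

Definition VAN (R : realType) (A : topologicalType) (phi : R -> R)
    (h : A -> R) : Prop :=
  forall h' : A -> R, proper_exhaustion h' -> coarsely_affine h' h ->
  forall (f : A -> R) (L : R), continuous f ->
    Climsup phi h f L = 0%E -> Climsup phi h' f L = 0%E.

Definition Dh (R : realType) (A : Type) (phi : R -> R) (h : A -> R)
    (lambda : R) : \bar R :=
  ereal_sup [set (phi (lambda * t) / phi t)%:E | t in range h].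

Definition Eh (R : realType) (A : Type) (phi : R -> R) (h : A -> R)
    (lambda : R) : \bar R :=
  ereal_sup [set (phi t / phi (t / lambda))%:E | t in range h].

Definition Dglob (R : realType) (phi : R -> R) (lambda : R) : \bar R :=
  ereal_sup [set (phi (lambda * t) / phi t)%:E | t in `[0, +oo[].

Definition globally_bounded_dilation (R : realType) (phi : R -> R) : Prop :=
  forall lambda : R, 1 <= lambda -> (Dglob phi lambda < +oo)%E.

(* Main.v *)
Require Import Defs.
From HB Require Import structures.
From mathcomp Require Import all_boot all_order all_algebra.
From mathcomp Require Import all_classical all_reals all_analysis.
From mathcomp Require Import ring lra.
Import Order.TTheory GRing.Theory Num.Theory numFieldNormedType.Exports.
Local Open Scope classical_set_scope.
Local Open Scope ring_scope.

(* If h' <= l h + b, then phi(h') <= K phi(b) phi(l h), so a finite D_h(l) gives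
   a domination of the limsup for h' by a multiple of the limsup for h. If
   D_h(l) is infinite, some f has limsup 0 for h but limsup at least 1 for l h,
   so that h' = l h violates (VAN). As E_h(l) = D_(h/l)(l), the same two facts
   applied to h/l in place of h settle E_h. When h(A) contains [t0, +oo[, the
   suprema over h(A) and over [0, +oo[ differ only through the compact [0, t0],
   and E_h(l) <= D(l) because t/l ranges over [0, +oo[. *)

(** * Finite suprema as real bounds *)

Lemma ereal_sup_image_ltyP (R : realType) (T : Type) (X : set T) (F : T -> R) :
  (ereal_sup [set (F t)%:E | t in X] < +oo)%E <->
  exists C : R, forall t, X t -> F t <= C.
Proof.
split=> [fin | [C FC]]; last first.
  by apply: le_lt_trans (ltry C); apply: ge_ereal_sup => _ [t Xt <-]; rewrite lee_fin FC.
exists (fine (ereal_sup [set (F t)%:E | t in X])) => t Xt.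
have le_sup : ((F t)%:E <= ereal_sup [set (F t)%:E | t in X])%E.
  by apply: ereal_sup_ubound; exists t.
rewrite -lee_fin fineK // fin_real // fin.
by rewrite (lt_le_trans (ltNyr (F t))).
Qed.

(** The bound is normalised to [1 <= C] because (INV) asks for such a constant and products of such
    constants stay at least 1. *)
Lemma Dh_ltyP (R : realType) (A : Type) (phi : R -> R) (h : A -> R) (l : R) :
  (forall a, 0 < phi (h a)) ->
  (Dh phi h l < +oo)%E <->
  exists2 C : R, 1 <= C & forall a, phi (l * h a) <= C * phi (h a).
Proof.
move=> phi_gt0; rewrite /Dh ereal_sup_image_ltyP.
split=> [[C hC]|[C _ hC]].
  exists (Num.max 1 C) => [|a]; first by rewrite le_max lexx.
  rewrite -ler_pdivrMr // le_max; apply/orP; right.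
  by apply: (hC (h a)); exists a.
by exists C => _ [a _ <-]; rewrite ler_pdivrMr.
Qed.

(** * Continuity criteria and tent functions *)

Lemma continuous_comp_within (T U V : topologicalType) (D : set U)
    (f : U -> V) (g : T -> U) :
  {within D, continuous f} -> continuous g -> (forall t, D (g t)) ->
  continuous (f \o g).
Proof.
move=> /subspace_continuousP fcont gcont Dg t W /(fcont _ (Dg t)) fW.
have {fW} : nbhs (g t) (fun u => D u -> W (f u)) by exact: fW.
by move=> /gcont; rewrite !nbhs_simpl /=; apply: filterS => s /(_ (Dg s)).
Qed.

(** Exchanging [s] and [t] turns the one-sided bound into the 1-Lipschitz property; the one-sided
    form suits a supremum. *)
Lemma continuous_le_dist (R : realType) (g : R -> R) :
  (forall s t, g s <= g t + `|s - t|) -> continuous g.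
Proof.
move=> lip t; apply/cvgrPdist_lt => e e0; near=> s.
have ts : `|t - s| < e by near: s; apply: cvgr_dist_lt.
apply: le_lt_trans ts; rewrite ler_norml.
by have := lip s t; have := lip t s; rewrite (distrC s t); lra.
Unshelve. all: by end_near. Qed.

(* No separation of the points c n is needed: the supremum of the tents of
   height 1/(n+1) around them is 1-Lipschitz, and it vanishes at infinity since
   only finitely many tents are higher than a given e. *)
Lemma spikes (R : realType) (c : nat -> R) :
  exists g : R -> R,
    [/\ continuous g, forall t, 0 <= g t, forall n, n.+1%:R^-1 <= g (c n) &
        forall e : R, 0 < e -> exists M, forall t, M < t -> g t <= e].
Proof.
pose s t n : R := Num.max 0 (n.+1%:R^-1 - `|t - c n|).
have inv1 n : n.+1%:R^-1 <= 1 :> R by rewrite invf_le1 ?ltr0n // ler1n.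
have s_ge0 t n : 0 <= s t n by rewrite le_max lexx.
have s_le1 t n : s t n <= n.+1%:R^-1.
  by rewrite ge_max invr_ge0 ler0n /= gerBl.
have sub t : has_ubound (range (s t)).
  by exists 1 => _ [n _ <-]; apply: le_trans (inv1 n).
have s0 t : range (s t) !=set0 by exists (s t 0%N); exists 0%N.
have le_g t n : s t n <= sup (range (s t)) by apply: ub_le_sup => //; exists n.
exists (fun t => sup (range (s t))); split.
- apply: continuous_le_dist => t u; apply: ge_sup => // _ [n _ <-].
  rewrite ge_max; apply/andP; split.
    by rewrite addr_ge0 // (le_trans (s_ge0 u 0%N)).
  apply: (@le_trans _ _ (s u n + `|t - u|)); last by rewrite lerD2r.
  rewrite -lerBlDr le_max; apply/orP; right.
  by move: (ler_distD t u (c n)) n.+1%:R^-1; rewrite (distrC u t) => tri x; lra.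
- by move=> t; apply: le_trans (le_g t 0%N).
- by move=> n; apply: le_trans (le_g _ n); rewrite le_max subrr normr0 subr0 lexx orbT.
- move=> e e0.
  have [N Ne] : exists N, forall n, (N <= n)%N -> n.+1%:R^-1 <= e.
    have [N _ hN] := near_infty_natSinv_lt (PosNum e0).
    by exists N => n /hN /ltW.
  (* Beyond this point [t] is at distance more than 1 from each [c n] with [n < N], and a tent
     reaches at most 1 from its centre. The other tents have height at most [e]. *)
  exists (1 + \sum_(n < N) `|c n|) => t tM; apply: ge_sup => // _ [n _ <-].
  have [nN|/Ne] := ltnP n N; last exact: le_trans.
  have cn : c n <= \sum_(n < N) `|c n|.
    rewrite (bigD1 (Ordinal nN)) //= (le_trans (ler_norm _)) // lerDl.
    by rewrite sumr_ge0.
  rewrite ge_max ltW //=.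
  by move: (ler_norm (t - c n)) (inv1 n); move: n.+1%:R^-1 => x; lra.
Qed.

(** * Limsups at infinity and proper exhaustions *)

(** The set where [h' > l * M + b] lies inside the set where [h > M], so the suprema compare for
    each [M]. *)
Lemma Climsup_le (R : realType) (A : topologicalType) (phi : R -> R)
    (h h' f : A -> R) (L C l b : R) : 0 < C -> 0 < l ->
  (forall a, h' a <= l * h a + b) -> (forall a, phi (h' a) <= C * phi (h a)) ->
  (Climsup phi h' f L <= C%:E * Climsup phi h f L)%E.
Proof.
move=> C0 l0 hh' phih; rewrite -lee_pdivrMl //.
rewrite {2}/Climsup limf_esupE; apply: le_ereal_inf_tmp => _ [V [M _ MV] <-].
rewrite lee_pdivrMl // /Climsup limf_esupE; apply: ge_ereal_inf.
exists (ereal_sup [set (phi (h' a) * `|f a - L|)%:E |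
  a in [set a | l * M + b < h' a]]).
  by exists [set a | l * M + b < h' a] => //; exists (l * M + b).
apply: ge_ereal_sup => _ [a /= Ma <-]; rewrite -lee_pdivrMl //.
apply: le_ereal_sup_tmp; exists (phi (h a) * `|f a - L|)%:E.
  exists a => //; apply: MV => /=.
  by rewrite -(ltr_pM2l l0); have := hh' a; lra.
by rewrite lee_pdivrMl // lee_fin mulrA ler_wpM2r.
Qed.

(** Unboundedness makes every set [h > M] nonempty; a supremum over the empty set would be -oo. *)
Lemma Climsup_ge0 (R : realType) (A : topologicalType) (phi : R -> R)
    (h f : A -> R) (L : R) :
  ~ has_ubound (range h) -> (forall a, 0 <= phi (h a)) ->
  (0 <= Climsup phi h f L)%E.
Proof.
move=> unb phi0; rewrite /Climsup limf_esupE.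
apply: le_ereal_inf_tmp => _ [V [M _ MV] <-].
have [a Ma] : exists a, M < h a.
  apply: contrapT => /forallNP noa; apply: unb; exists M => _ [a _ <-].
  by rewrite leNgt; apply/negP.
apply: le_ereal_sup_tmp; exists (phi (h a) * `|f a - L|)%:E.
  by exists a => //; apply: MV.
by rewrite lee_fin mulr_ge0.
Qed.

Lemma proper_exhaustion_unbounded (R : realType) (A : topologicalType)
    (h : A -> R) :
  ~ compact [set: A] -> proper_exhaustion h -> ~ has_ubound (range h).
Proof.
move=> ncA [h0 _ hK] [M hM]; apply: ncA; suff <- : h @^-1` `[0, M] = setT by [].
by apply/seteqP; split=> a //= _; rewrite in_itv /= h0 hM //; exists a.
Qed.

Lemma proper_exhaustionZ (R : realType) (A : topologicalType) (h : A -> R)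
    (l : R) : 0 < l -> proper_exhaustion h ->
  proper_exhaustion (fun a => l * h a).
Proof.
move=> l0 [h0 hc hK]; split=> [a|a|r].
- by rewrite mulr_ge0 // ltW.
- by apply: cvgM; [exact: cvg_cst|exact: hc].
- suff -> : (fun a => l * h a) @^-1` `[0, r] = h @^-1` `[0, r / l] by [].
  apply/seteqP; split=> a /=; rewrite !in_itv /= h0 mulr_ge0 ?(ltW l0) //=.
    by rewrite ler_pdivlMr // mulrC.
  by rewrite ler_pdivlMr // mulrC.
Qed.

Lemma coarsely_affineZ (R : realType) (A : Type) (h : A -> R) (l : R) :
  0 < l -> coarsely_affine (fun a => l * h a) h.
Proof.
move=> l0; exists l^-1, l^-1, 0, 0; rewrite !invr_gt0; split=> // a.
by rewrite subr0 addr0 mulKf ?lexx ?gt_eqF.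
Qed.

Lemma Eh_Dh (R : realType) (A : Type) (phi : R -> R) (h : A -> R) (l : R) :
  0 < l -> Eh phi h l = Dh phi (fun a => l^-1 * h a) l.
Proof.
move=> l0; rewrite /Eh /Dh; congr ereal_sup; apply/seteqP; split=> y [_ [a _ <-] <-].
  exists (l^-1 * h a); first by exists a.
  by rewrite mulVKf ?gt_eqF // [h a / l]mulrC.
exists (h a); first by exists a.
by rewrite mulVKf ?gt_eqF // [h a / l]mulrC.
Qed.

Lemma coarsely_affine_bounds (R : realType) (A : Type) (h h' : A -> R) :
  (forall a, 0 <= h a) -> (forall a, 0 <= h' a) -> coarsely_affine h' h ->
  exists l b : R, [/\ 1 <= l, 0 <= b, forall a, h' a <= l * h a + b &
    forall a, h a <= l * h' a + b].
Proof.
move=> h0 h'0 [a1 [a2 [b1 [b2 [a1_gt0 a2_gt0 b1_ge0 b2_ge0 hh']]]]].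
have ia1 : 0 < a1^-1 by rewrite invr_gt0.
have c0 : 0 <= a1^-1 * b1 by rewrite mulr_ge0 // ltW.
(* One slope for both directions: it dominates 1, [a2] and [a1^-1], and enlarging a slope is
   harmless since [h] and [h'] are nonnegative. *)
exists (1 + a2 + a1^-1), (b2 + a1^-1 * b1); split=> [| |a|a].
- by rewrite -addrA lerDl addr_ge0 ?ltW.
- by rewrite addr_ge0.
- have [le1 _] := andP (hh' a).
  have le2 : h' a <= a1^-1 * (h a + b1) by rewrite ler_pdivlMl // -lerBlDr.
  have : 0 <= (1 + a2) * h a by rewrite mulr_ge0 ?addr_ge0 // ltW.
  by move: le2; rewrite !mulrDl mulrDr; lra.
- have [_ le1] := andP (hh' a).
  have : 0 <= (1 + a1^-1) * h' a by rewrite mulr_ge0 ?addr_ge0 // ltW.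
  by rewrite !mulrDl; lra.
Qed.

(** * Admissible functions: domination and counterexample *)

Section AdmissibleFunction.
Variables (R : realType) (phi : R -> R).
Hypothesis phi_adm : admissible phi.

Lemma admissible_ge1 (t : R) : 0 <= t -> 1 <= phi t.
Proof. by case: phi_adm => + _ _ _ _; apply. Qed.

Lemma admissible_gt0 (t : R) : 0 <= t -> 0 < phi t.
Proof. by move=> /admissible_ge1; apply: lt_le_trans. Qed.

Lemma admissible_homo (s t : R) : 0 <= s -> s <= t -> phi s <= phi t.
Proof.
case: phi_adm => _ _ homo _ _ s0 st; apply: homo => //; rewrite in_itv /= andbT //.
exact: le_trans st.
Qed.

Section ProperExhaustions.
Variable A : topologicalType.

(** A one-sided affine bound gives a one-sided domination, so that (INV) can chain several of
    them. *)
Lemma Climsup_dominated (h h' : A -> R) (l b : R) :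
  (forall a, 0 <= h a) -> (forall a, 0 <= h' a) -> 1 <= l -> 0 <= b ->
  (forall a, h' a <= l * h a + b) -> (Dh phi h l < +oo)%E ->
  exists2 C : R, 1 <= C & forall f L,
    (Climsup phi h' f L <= C%:E * Climsup phi h f L)%E.
Proof.
move=> h0 h'0 l1 b0 hh' /Dh_ltyP [a|D D1 hD]; first exact: admissible_gt0.
have l0 : 0 < l by apply: lt_le_trans l1.
have [_ _ _ _ [K K1 phiM]] := phi_adm.
have C1 : 1 <= K * D * phi b by rewrite !mulr_ege1 // admissible_ge1.
exists (K * D * phi b) => // f L; apply: (Climsup_le _ _ _ h _ _ _ _ l b) => //.
  exact: lt_le_trans C1.
move=> a; have lh0 : 0 <= l * h a by rewrite mulr_ge0 // ltW.
apply: le_trans (admissible_homo _ _ _ (hh' a)) _ => //.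
apply: le_trans (phiM _ _ lh0 b0) _.
rewrite [leRHS]mulrAC ler_pM2r ?admissible_gt0 // -mulrA ler_pM2l //.
exact: lt_le_trans K1.
Qed.

(* The witness is g(h) / phi(h), with g peaking at values h(x n) such that
   phi(l h(x n)) > (n+1) phi(h(x n)); these values are unbounded because
   phi(l t) is bounded for bounded t. *)
Lemma Dh_infinite_witness (h : A -> R) (l : R) :
  ~ compact [set: A] -> proper_exhaustion h -> 1 <= l ->
  ~ (Dh phi h l < +oo)%E ->
  exists f : A -> R, [/\ continuous f, Climsup phi h f 0 = 0%E &
    (1 <= Climsup phi (fun a => (l * h a)%R) f 0)%E].
Proof.
move=> ncA hp l1 Dinf; have [h0 hc _] := hp.
have lh0 a : 0 <= l * h a by rewrite mulr_ge0 // (le_trans ler01).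
have /choice[x hx] : forall n : nat, exists a, n.+1%:R * phi (h a) < phi (l * h a).
  move=> n; apply: contrapT => /forallNP noa; apply: Dinf; apply/Dh_ltyP.
    by move=> a; apply: admissible_gt0.
  by exists n.+1%:R => [|a]; rewrite ?ler1n // leNgt; apply/negP.
have [g [gc g0 gx g_vanishes]] := spikes R (fun n => h (x n)).
have phihc : continuous (phi \o h).
  have [_ phic _ _ _] := phi_adm.
  apply: (continuous_comp_within _ _ _ _ _ _ phic hc) => a.
  by rewrite /= in_itv /= h0.
have phih0 a : 0 < phi (h a) by apply: admissible_gt0.
have quot_ge0 a : 0 <= g (h a) / phi (h a) by rewrite divr_ge0 // ltW.
exists (fun a => g (h a) / phi (h a)); split.
- move=> a; apply: cvgM; last first.
    by apply: cvgV; [rewrite gt_eqF | exact: phihc].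
  by apply: (@continuous_comp _ _ _ h g); [exact: hc | exact: gc].
- apply: le_anti; rewrite Climsup_ge0 ?andbT; last 2 first.
  + exact: proper_exhaustion_unbounded.
  + by move=> a; rewrite ltW.
  (* The weighted function [phi (h a) * f a] is [g (h a)], which is eventually at most [e]. *)
  apply/lee_addgt0Pr => e e0; rewrite add0e /Climsup limf_esupE.
  have [M hM] := g_vanishes e e0.
  apply: ge_ereal_inf; exists (ereal_sup [set
      (phi (h a) * `|g (h a) / phi (h a) - 0|)%:E | a in [set a | M < h a]]).
    by exists [set a | M < h a] => //; exists M.
  apply: ge_ereal_sup => _ [a /= /hM ge <-].
  by rewrite subr0 ger0_norm // lee_fin mulrCA divff ?mulr1 // gt_eqF.
- rewrite /Climsup limf_esupE; apply: le_ereal_inf_tmp => _ [V [M _ MV] <-].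
  (* Now [phi M < n.+1]. If [l * h (x n) <= M], monotonicity would give [phi (l * h (x n)) < n.+1 <=
     n.+1 * phi (h (x n))], against the choice of [x n]. *)
  set n := Num.truncn (phi M).
  apply: le_ereal_sup_tmp; exists (phi (l * h (x n)) *
    `|g (h (x n)) / phi (h (x n)) - 0|)%:E.
    exists (x n) => //; apply: MV => /=; rewrite ltNge; apply/negP => lhM.
    have := admissible_homo _ _ (lh0 _) lhM; rewrite leNgt => /negP; apply.
    apply: lt_trans (hx n); apply: (lt_le_trans (truncnS_gt (phi M))).
    by rewrite ler_peMr ?ler0n // admissible_ge1.
  rewrite subr0 ger0_norm // lee_fin mulrA ler_pdivlMr // mul1r.
  have n0 : 0 < n.+1%:R :> R by rewrite ltr0n.
  (* The growth factor [n.+1] cancels the peak height [n.+1^-1]. *)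
  apply: le_trans (_ : n.+1%:R * phi (h (x n)) * n.+1%:R^-1 <= _).
    by rewrite mulrAC divff ?mul1r // gt_eqF.
  apply: ler_pM; [by rewrite ltW // mulr_gt0 | by rewrite invr_ge0 | | exact: gx].
  by rewrite ltW.
Qed.

(** * Criteria for (VAN) and (INV) *)

Hypothesis A_noncompact : ~ compact [set: A].
Variable h : A -> R.
Hypothesis h_exh : proper_exhaustion h.

Let h_ge0 a : 0 <= h a. Proof. by case: h_exh. Qed.

Let Climsup_phi_ge0 (k f : A -> R) (L : R) :
  proper_exhaustion k -> (0 <= Climsup phi k f L)%E.
Proof.
move=> kp; apply: Climsup_ge0; first exact: proper_exhaustion_unbounded.
by move=> a; apply/ltW/admissible_gt0; case: kp.
Qed.

Lemma INV_VAN : INV phi h -> VAN phi h.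
Proof.
move=> inv h' h'p hh' f L fc h_0; have [C _ /(_ f L fc) [_]] := inv h' h'p hh'.
by rewrite h_0 mule0 => le0; apply: le_anti; rewrite le0 Climsup_phi_ge0.
Qed.

Lemma VAN_iff_Dh : VAN phi h <-> (forall l : R, 1 <= l -> (Dh phi h l < +oo)%E).
Proof.
split=> [van l l1|Dfin h' h'p hh' f L fc h_0].
  apply: contrapT => /(Dh_infinite_witness _ _ A_noncompact h_exh l1).
  move=> [f [fc f0]]; have l0 : 0 < l by apply: lt_le_trans l1.
  have := van _ (proper_exhaustionZ _ _ _ _ l0 h_exh)
    (coarsely_affineZ _ _ h _ l0) f 0 fc f0.
  by move=> ->; rewrite lee_fin ler10.
have h'0 : forall a, 0 <= h' a by case: h'p.
have [l [b [l1 b0 h'_le _]]] := coarsely_affine_bounds _ _ _ _ h_ge0 h'0 hh'.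
have [C _ /(_ f L)] :=
  Climsup_dominated _ _ _ _ h_ge0 h'0 l1 b0 h'_le (Dfin l l1).
by rewrite h_0 mule0 => le0; apply: le_anti; rewrite le0 Climsup_phi_ge0.
Qed.

(** With [h/l] as the comparison exhaustion, the witness has limsup 0 for [h/l] and at least 1 for
    [h], so the lower inequality of (INV) fails. *)
Lemma INV_Eh (l : R) : INV phi h -> 1 <= l -> (Eh phi h l < +oo)%E.
Proof.
move=> inv l1; have l0 : 0 < l by apply: lt_le_trans l1.
have il0 : 0 < l^-1 by rewrite invr_gt0.
have kp := proper_exhaustionZ _ _ _ _ il0 h_exh.
rewrite Eh_Dh //; apply: contrapT.
move=> /(Dh_infinite_witness _ _ A_noncompact kp l1) [f [fc f0 f1]].
have [C C1 /(_ f 0 fc) [+ _]] := inv _ kp (coarsely_affineZ _ _ h _ il0).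
have C0 : 0 < C by apply: lt_le_trans C1.
have scaleK : (fun a => l * (l^-1 * h a)) = h.
  by apply/funext => a; rewrite mulVKf ?gt_eqF.
rewrite scaleK in f1; rewrite f0 lee_pdivrMl // mule0 => /(le_trans f1).
by rewrite lee_fin ler10.
Qed.

Lemma INV_iff_Dh_Eh : INV phi h <->
  (forall l : R, 1 <= l -> (Dh phi h l < +oo)%E /\ (Eh phi h l < +oo)%E).
Proof.
split=> [inv l l1|DEfin h' h'p hh'].
  by split; [apply: (VAN_iff_Dh.1 (INV_VAN inv)) l1 | apply: INV_Eh].
have h'0 : forall a, 0 <= h' a by case: h'p.
have [l [b [l1 b0 h'_le h_le]]] := coarsely_affine_bounds _ _ _ _ h_ge0 h'0 hh'.
have [Dfin Efin] := DEfin l l1; have l0 : 0 < l by apply: lt_le_trans l1.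
have il0 : 0 < l^-1 by rewrite invr_gt0.
(* The lower bound passes through [k]: the step from [h = l * k] to [k] costs [D_k(l) = E_h(l)], and
   the step from [k <= h' + b/l] to [h'] has slope 1, where [D_h'(1) <= 1]. *)
pose k a := l^-1 * h a; have kp : proper_exhaustion k by apply: proper_exhaustionZ.
have k0 : forall a, 0 <= k a by case: kp.
have [C C1 hC] :=
  Climsup_dominated _ _ _ _ h_ge0 h'0 l1 b0 h'_le Dfin.
have [Ch Ch1 hCh] : exists2 C : R, 1 <= C & forall f L,
    (Climsup phi h f L <= C%:E * Climsup phi k f L)%E.
  apply: (Climsup_dominated _ _ l 0) => //; last by rewrite -Eh_Dh.
  by move=> a; rewrite addr0 mulVKf ?gt_eqF.
have [Ck Ck1 hCk] : exists2 C : R, 1 <= C & forall f L,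
    (Climsup phi k f L <= C%:E * Climsup phi h' f L)%E.
  apply: (Climsup_dominated _ _ 1 (l^-1 * b)) => //.
  - by rewrite mulr_ge0 // ltW.
  - by move=> a; rewrite mul1r ler_pdivrMl // mulrDr mulVKf ?gt_eqF.
  - apply/Dh_ltyP => [a|]; first exact: admissible_gt0.
    by exists 1 => // a; rewrite !mul1r.
have ChCk1 : 1 <= Ch * Ck by rewrite mulr_ege1.
(* The sum dominates [C], used for the upper bound, and [Ch * Ck], used for the lower one. *)
exists (C + Ch * Ck) => [|f L _].
  by apply: le_trans C1 _; rewrite lerDl (le_trans ler01).
have h'_ge0 := Climsup_phi_ge0 h' f L h'p.
split; last first.
  apply: le_trans (hC f L) _; rewrite lee_wpmul2r ?Climsup_phi_ge0 //.
  by rewrite lee_fin lerDl (le_trans ler01).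
rewrite lee_pdivrMl; last by rewrite addr_gt0 // (lt_le_trans ltr01).
apply: le_trans (hCh f L) _.
have Ch0 : (0 <= Ch%:E)%E by rewrite lee_fin (le_trans ler01).
apply: le_trans (lee_wpmul2l Ch0 (hCk f L)) _.
rewrite muleA -EFinM lee_wpmul2r // lee_fin lerDr.
exact: le_trans C1.
Qed.

Lemma VAN_INV_iff_globally_bounded_dilation (t0 : R) : `[t0, +oo[ `<=` range h ->
  (INV phi h <-> VAN phi h) /\ (VAN phi h <-> globally_bounded_dilation phi).
Proof.
move=> t0h.
(* [t0] may be negative. On [[0, T]] the quotient [phi (l * t) / phi t] is at most [phi (l * T)],
   because [phi t >= 1]. *)
pose T := Num.max 0 t0.
have T0 : 0 <= T by rewrite le_max lexx.
have rangeT t : T <= t -> range h t.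
  by move=> Tt; apply: t0h;
    rewrite /= in_itv /= andbT (le_trans _ Tt) // le_max lexx orbT.
have small (l s : R) : 1 <= l -> 0 <= s -> s <= T -> phi (l * s) <= phi (l * T).
  move=> l1 s0 sT; have l0 : 0 < l by apply: lt_le_trans l1.
  by apply: admissible_homo; rewrite ?mulr_ge0 ?(ltW l0) // ler_pM2l.
have Dglob_Dh : (forall l : R, 1 <= l -> (Dh phi h l < +oo)%E) ->
    globally_bounded_dilation phi.
  move=> Dfin l l1; have /ereal_sup_image_ltyP [C hC] := Dfin l l1.
  apply/ereal_sup_image_ltyP; exists (Num.max C (phi (l * T))) => t.
  rewrite /= in_itv /= andbT => t_ge0; rewrite le_max.
  have [Tt|/ltW tT] := leP T t; first by rewrite hC //; apply: rangeT.
  apply/orP; right; rewrite ler_pdivrMr ?admissible_gt0 //.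
  apply: le_trans (small l t l1 t_ge0 tT) _; rewrite ler_peMr ?admissible_ge1 //.
  by rewrite ltW // admissible_gt0 // mulr_ge0 // (le_trans ler01).
have Dh_Dglob : globally_bounded_dilation phi ->
    forall l : R, 1 <= l -> (Dh phi h l < +oo)%E.
  move=> gbd l /gbd /ereal_sup_image_ltyP [C hC]; apply/ereal_sup_image_ltyP.
  by exists C => _ [a _ <-]; apply: hC; rewrite /= in_itv /= h_ge0.
have Eh_Dglob : globally_bounded_dilation phi ->
    forall l : R, 1 <= l -> (Eh phi h l < +oo)%E.
  move=> gbd l l1; have l0 : 0 < l by apply: lt_le_trans l1.
  have /ereal_sup_image_ltyP [C hC] := gbd l l1; apply/ereal_sup_image_ltyP.
  exists C => _ [a _ <-]; have := hC (h a / l).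
  by rewrite (mulrC l) divfK ?gt_eqF //; apply; rewrite /= in_itv /= divr_ge0 // ltW.
split; split=> [|van].
- exact: INV_VAN.
- apply/INV_iff_Dh_Eh => l l1; have gbd := Dglob_Dh (VAN_iff_Dh.1 van).
  by split; [exact: Dh_Dglob | exact: Eh_Dglob].
- by move=> /VAN_iff_Dh.
- by apply/VAN_iff_Dh/Dh_Dglob.
Qed.

End ProperExhaustions.

End AdmissibleFunction.

(** * Assembly and the connected case *)

Theorem theorem4p26 (R : realType) (A : topologicalType)
    (A_hausdorff : hausdorff_space A)
    (A_locally_compact : locally_compact [set: A])
    (A_sigma_compact : sigma_compact A)
    (A_noncompact : ~ compact [set: A])
    (h : A -> R) (h_exh : proper_exhaustion h)
    (phi : R -> R) (phi_adm : admissible phi) :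
  [/\ (* (a) *)
      VAN phi h <-> (forall lambda : R, 1 <= lambda -> (Dh phi h lambda < +oo)%E),
      (* (b) *)
      INV phi h <-> (forall lambda : R, 1 <= lambda ->
                       (Dh phi h lambda < +oo)%E /\ (Eh phi h lambda < +oo)%E),
      (* (c) *)
      (exists t0 : R, `[t0, +oo[ `<=` range h) ->
        (INV phi h <-> VAN phi h) /\
        (VAN phi h <-> globally_bounded_dilation phi)
    & (* (c), connected case *)
      connected [set: A] ->
        [/\ is_interval (range h),
            ~ has_ubound (range h),
            exists t0 : R, `[t0, +oo[ `<=` range h
          & (INV phi h <-> VAN phi h) /\
            (VAN phi h <-> globally_bounded_dilation phi)]].
Proof.
have VAN_iff := VAN_iff_Dh _ _ phi_adm _ A_noncompact _ h_exh.
have INV_iff := INV_iff_Dh_Eh _ _ phi_adm _ A_noncompact _ h_exh.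
have all_equiv := VAN_INV_iff_globally_bounded_dilation _ _
  phi_adm _ A_noncompact _ h_exh.
split=> // [[t0]|Aconn]; first exact: all_equiv.
have hitv : is_interval (range h).
  apply/connected_intervalP; apply: connected_continuous_connected => //.
  by apply: continuous_subspaceT; case: h_exh.
have hunb := proper_exhaustion_unbounded _ _ _ A_noncompact h_exh.
have [t0 ht0] : exists t0 : R, `[t0, +oo[ `<=` range h.
  (* Any value [h a] serves as [t0]: each [t >= h a] lies below some [h b], hence in the interval
     [range h]. A point [a] exists since the empty space is compact. *)
  have [a _] : [set: A] !=set0.
    by apply/set0P/eqP => A0; apply: A_noncompact; rewrite A0; apply: compact0.
  exists (h a) => t; rewrite /= in_itv /= andbT => hat.
  have [b tb] : exists b, t < h b.
    apply: contrapT => /forallNP nob; apply: hunb; exists t => _ [b _ <-].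
    by rewrite leNgt; apply/negP.
  by apply: (hitv (h a) (h b)); [exists a | exists b | rewrite hat ltW].
by split=> //; [exists t0 | exact: all_equiv ht0].
Qed.
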